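(* If a Hausdorff topological semigroup $S$ contains the semigroup $\mathbf{ID}_{\infty}$ as a subsemigroup and the subspace $\mathbf{ID}_{\infty}$ of $S$ has an isolated point (isolated in $\mathbf{ID}_{\infty}$), then the square $S\times S$ is not a countably compact space.
   Context: A partial cofinite isometry of the set of integers $\mathbb{Z}$ is a partial map $\alpha\colon\mathbb{Z}\rightharpoonup\mathbb{Z}$ such that $\mathbb{Z}\setminus\operatorname{dom}\alpha$ and $\mathbb{Z}\setminus\operatorname{ran}\alpha$ are finite and $|(x)\alpha-(y)\alpha|=|x-y|$ for all $x,y\in\operatorname{dom}\alpha$. $\mathbf{ID}_{\infty}$ is the semigroup (an inverse monoid) of all partial cofinite isometries of $\mathbb{Z}$ under composition of partial maps (maps written on the right). A topological semigroup is a topological space with a jointly continuous semigroup operation. A space is countably compact if each of its countable open covers has a finite subcover. *)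

(* Defs.v *)
From HB Require Import structures.
From mathcomp Require Import all_boot all_order all_algebra.
From mathcomp Require Import all_classical all_reals all_analysis.

Set Implicit Arguments.
Unset Strict Implicit.
Unset Printing Implicit Defensive.

Import Order.TTheory GRing.Theory Num.Theory.

Local Open Scope classical_set_scope.
Local Open Scope ring_scope.

(* A partial map [int -> int] is an [int -> option int]; [None] means
   "undefined". *)
Section PartialMaps.
Implicit Types f g : int -> option int.

Definition pdom f : set int := [set x | exists y, f x = Some y].
Definition pran f : set int := [set y | exists x, f x = Some y].

Definition partial_cofinite_isometry f : Prop :=
  [/\ cofinite_set (pdom f), cofinite_set (pran f) &
      forall x y x' y' : int, f x = Some x' -> f y = Some y' ->
        `|x' - y'| = `|x - y|].

Lemma partial_isometry_inj f x y z : partial_cofinite_isometry f ->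
  f x = Some z -> f y = Some z -> x = y.
Proof.
move=> [_ _ fiso] fx fy; apply/eqP.
by rewrite -subr_eq0 -normr_eq0 -(fiso _ _ _ _ fx fy) subrr normr0.
Qed.

(* Maps act on the right: [pcomp g f] is "first [f], then [g]". *)
Lemma partial_cofinite_isometry_comp f g :
  partial_cofinite_isometry f -> partial_cofinite_isometry g ->
  partial_cofinite_isometry (pcomp g f).
Proof.
move=> fP gP; have [fd fr fi] := fP; have [gd gr gi] := gP.
have sub_image (h : int -> option int) (A : set int) : finite_set A ->
    finite_set [set y | exists2 x, A x & h x = Some y].
  move=> Afin.
  apply: (@sub_finite_set _ _ ((fun x => odflt 0 (h x)) @` A)).
    by move=> y /= [x Ax hx]; exists x; rewrite ?hx.
  exact: finite_image.
have sub_preimage (A : set int) : finite_set A ->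
    finite_set [set x | exists2 y, A y & f x = Some y].
  move=> Afin.
  pose h y : option int := if pselect (exists x, f x = Some y) is left e
    then Some (projT1 (cid e)) else None.
  apply: sub_finite_set (sub_image h A Afin) => x /= [y Ay fx].
  exists y => //; rewrite /h; case: pselect => [e|[]]; last by exists x.
  by congr Some; apply: partial_isometry_inj fP (projT2 (cid e)) fx.
split.
- have : finite_set (~` pdom f `|` [set x | exists2 y, (~` pdom g) y & f x = Some y]).
    by rewrite finite_setU; split => //; exact: sub_preimage.
  apply: sub_finite_set => x /= nx.
  case fx : (f x) => [y|]; last by left => -[y]; rewrite fx.
  right; exists y => // -[z gy]; apply: nx; exists z.
  by rewrite /pcomp fx.
- have : finite_set (~` pran g `|` [set z | exists2 y, (~` pran f) y & g y = Some z]).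
    by rewrite finite_setU; split => //; exact: sub_image.
  apply: sub_finite_set => z /= nz.
  have [[y gy]|nex] := pselect (exists y, g y = Some z); last by left.
  right; exists y => // -[x fx]; apply: nz; exists x.
  by rewrite /pcomp fx.
- move=> x y x' y'; rewrite /pcomp.
  case fx : (f x) => [u|] //=; case fy : (f y) => [v|] //= gu gv.
  by rewrite (gi _ _ _ _ gu gv) (fi _ _ _ _ fx fy).
Qed.

End PartialMaps.

Record IDinf := MkIDinf {
  ID_pmap :> int -> option int ;
  ID_pmapP : partial_cofinite_isometry ID_pmap }.

Lemma IDinf_eq (a b : IDinf) : ID_pmap a = ID_pmap b -> a = b.
Proof.
case: a b => [f fP] [g gP] /= fg; rewrite fg in fP *.
by congr MkIDinf; exact: Prop_irrelevance.
Qed.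

HB.instance Definition _ := gen_eqMixin IDinf.
HB.instance Definition _ := gen_choiceMixin IDinf.

Definition ID_mul (a b : IDinf) : IDinf :=
  MkIDinf (partial_cofinite_isometry_comp (ID_pmapP a) (ID_pmapP b)).

Lemma ID_mulA : associative ID_mul.
Proof.
move=> a b c; apply: IDinf_eq => /=; apply/funext => x.
by rewrite /pcomp; case: (ID_pmap a x).
Qed.

HB.instance Definition _ := isSemigroup.Build IDinf ID_mulA.

HB.structure Definition PreTopologicalSemigroup :=
  {S of Topological S & Semigroup S}.

HB.mixin Record PreTopologicalSemigroup_isTopologicalSemigroup S
    & PreTopologicalSemigroup S := {
  mulg_continuous : continuous (fun x : S * S => (x.1 * x.2)%g) ;
}.

#[short(type="topologicalSemigroupType")]
HB.structure Definition TopologicalSemigroup :=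
  {S of PreTopologicalSemigroup S
      & PreTopologicalSemigroup_isTopologicalSemigroup S}.

(* [cover_compact] restricted to countable index sets. *)
Definition countably_compact (T : topologicalType) (A : set T) : Prop :=
  forall (I : choiceType) (D : set I) (f : I -> set T),
    countable D -> (forall i, D i -> open (f i)) -> A `<=` cover D f ->
    finite_subset_cover D f A.

(* Main.v *)
Require Import Defs.
From mathcomp Require Import all_boot all_order all_algebra.
From mathcomp Require Import all_classical all_reals all_analysis.

(** Write [a] for the image [phi a] in [S] as well.  The translations
[t k : x |-> x + k] form a copy of the group of integers
inside the semigroup, and [a (t m) = a] only for [m = 0], because [a] is defined
somewhere.  If [S * S] were countably compact, the sequence of pairs
[(t n, t (- n))] would have a cluster point [p] ([countably_compact_cluster]).
The continuous map [h (u, v) = a u v] takes the value [a] at every term of the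
sequence, hence also at [p], since points of [S] are closed.  When [a] is
isolated in the semigroup, [h] has the value [a] at all pairs [(t n, t m)] close
to [p]: those of some box [V * W] around [p].  But the box contains the terms
of two distinct indices [n] and [m], and then [(t n, t (- m))] is in it too, so
[a (t (n - m)) = a], which is a contradiction. *)

Import Order.TTheory GRing.Theory Num.Theory.
Local Open Scope classical_set_scope.
Local Open Scope ring_scope.

(** Otherwise the complements of the closures of the tails of [u] are an
increasing countable open cover, and none of them contains all terms of [u]. *)
Lemma countably_compact_cluster (T : topologicalType) (u : nat -> T) :
  countably_compact [set: T] ->
  exists p : T, forall (V : set T) (N : nat), nbhs p V ->
    exists2 n, (N <= n)%N & V (u n).
Proof.
move=> ccT.
pose tail N := u @` [set n | (N <= n)%N].
have [[p clp]|ncl] := pselect (exists p, forall N, closure (tail N) p).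
  exists p => V N /(clp N)[_ [[n /= Nn <-] Vun]]; by exists n.
exfalso; have [] := ccT nat setT (fun N => ~` closure (tail N)).
- exact: countableP.
- by move=> N _; apply: closed_openC; exact: closed_closure.
- move=> p _; apply: contrapT => np; apply: ncl; exists p => N.
  by apply: contrapT => clN; apply: np; exists N.
move=> D _; pose M := (\max_(i <- finmap.enum_fset D) i)%N.
move=> /(_ (u M)) /= []// N /= ND nclN.
by apply: nclN; apply: subset_closure; exists M => //=; exact: leq_bigmax_seq.
Qed.

Definition shift (k : int) (x : int) : option int := Some (x + k).

Lemma shift_isometry k : partial_cofinite_isometry (shift k).
Proof.
have cofT : cofinite_set [set: int] by rewrite setCT.
split.
- suff -> : pdom (shift k) = setT by [].
  by apply/seteqP; split=> // x _; exists (x + k).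
- suff -> : pran (shift k) = setT by [].
  by apply/seteqP; split=> // x _; exists (x - k); rewrite /shift subrK.
- by move=> x y _ _ [<-] [<-]; rewrite opprD addrACA subrr addr0.
Qed.

Definition translation (k : int) : IDinf := MkIDinf (shift_isometry k).

Lemma translationD k l :
  (translation k * translation l)%g = translation (k + l).
Proof.
apply: IDinf_eq; apply/funext => x /=.
by rewrite /pcomp /shift /= addrA.
Qed.

Lemma mul_translation0 (a : IDinf) : (a * translation 0)%g = a.
Proof.
apply: IDinf_eq; apply/funext => x /=.
by rewrite /pcomp /shift; case: (ID_pmap a x) => //= y; rewrite addr0.
Qed.

Lemma IDinf_defined (a : IDinf) : exists x y, ID_pmap a x = Some y.
Proof.
have [cofin _ _] := ID_pmapP a; apply: contrapT => undef.
apply: infinite_nat.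
have dom0 : pdom (ID_pmap a) = set0.
  by apply/seteqP; split=> // x [y axy]; apply: undef; exists x, y.
rewrite dom0 setC0 in cofin.
suff : finite_set (Posz @^-1` [set: int]) by rewrite preimage_setT.
by apply: finite_preimage cofin => m n _ _ [].
Qed.

Lemma translation_fix (k : int) (a : IDinf) : (a * translation k)%g = a -> k = 0.
Proof.
have [x [y axy]] := IDinf_defined a.
move=> /(congr1 (fun b : IDinf => ID_pmap b x)) /=.
rewrite /pcomp axy /shift /= => -[].
by rewrite -[RHS]addr0 => /addrI.
Qed.

(* [S] contains the semigroup as a subsemigroup via the embedding [phi]. *)
Theorem mainTheorem10 (S : topologicalSemigroupType)
    (phi : {multiplicative IDinf -> S}) (phi_inj : injective phi)
    (S_hausdorff : hausdorff_space S)
    (ID_isolated : exists a : IDinf, isolated (range phi) (phi a)) :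
  ~ countably_compact [set: S * S].
Proof.
move=> ccSS; have [a [_ [U Ua Uisol]]] := ID_isolated.
pose t k := phi (translation k).
pose h (q : S * S) := (phi a * (q.1 * q.2))%g.
have h_cont : continuous h.
  move=> q; apply: (@continuous_comp _ _ _ (fun q : S * S => (phi a, q.1 * q.2)%g)
    (fun r : S * S => r.1 * r.2)%g); last exact: mulg_continuous.
  by apply: cvg_pair; [exact: cvg_cst|exact: mulg_continuous].
have hE k l : h (t k, t l) = phi (a * translation (k + l))%g.
  by rewrite -translationD !gmulfM.
have [p clp] := @countably_compact_cluster _ (fun n : nat => (t n, t (- n%:Z))) ccSS.
have hp : h p = phi a.
  apply: contrapT => hpa.
  have [n _] : exists2 n, (0 <= n)%N & (~` [set phi a]) (h (t n%:Z, t (- n%:Z))).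
    apply: (clp (h @^-1` ~` [set phi a]) 0%N); apply: h_cont.
    apply: open_nbhs_nbhs; split=> //; apply: closed_openC.
    exact/accessible_closed_set1/hausdorff_accessible.
  by apply; rewrite hE subrr mul_translation0.
have [[V W] [/= Vp Wp] VWU] : nbhs p (h @^-1` U) by apply: h_cont; rewrite hp.
have VWp : nbhs p (V `*` W) by exists (V, W).
(* Two terms of distinct indices in the box, to be mixed: the first component of
   one is paired with the second component of the other. *)
have [m _ [Vm _]] := clp _ 0%N VWp.
have [n mn [_ Wn]] := clp _ m.+1 VWp.
have : (U `&` range phi) (h (t m%:Z, t (- n%:Z))).
  by split; [exact: (VWU (_, _))|rewrite hE; exists (a * translation (m%:Z - n%:Z))%g].
rewrite Uisol hE /= => /phi_inj /translation_fix /eqP.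
by rewrite subr_eq0 => /eqP[mEn]; rewrite mEn ltnn in mn.
Qed.
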